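(* Let $f,g:\mathbb{R}^n\to\mathbb{R}^n$ be polynomial vector fields with $f(0)=0$, and consider the control system $\dot x=f(x)+u\,g(x)$ with scalar control $u$. Assume that $(f,g)$ admits a balanced super-linearization with exactly one visible observable. Then there exist an invertible matrix $P\in\mathbb{R}^{n\times n}$ and a partition $x'=(x_1',x_2')$ of the new variable $x'=Px$, with $x_1'\in\mathbb{R}^k$ and $x_2'\in\mathbb{R}^{n-k}$ for some $0\le k\le n$, such that the nonlinear term of the dynamics expressed in the $x'$ variables is a polynomial $p'(x_2')$ depending on $x_2'$ only, and the dynamics of $x_2'$ is linear and autonomous. Explicitly, there are matrices $A_{11}',A_{12}',A_{22}'$ and a vector $B'$ of appropriate sizes and a polynomial map $p':\mathbb{R}^{n-k}\to\mathbb{R}^k$ such that the system in the $x'$ variables reads $$\dot x_1'=A_{11}'x_1'+A_{12}'x_2'+p'(x_2')+u\,B',\qquad \dot x_2'=A_{22}'x_2'.$$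
   Context: The pair $(f,g)$ denotes the control system $\dot x=f(x)+u\,g(x)$ on $\mathbb{R}^n$, with $u$ a scalar control (a piecewise continuous function of time). Super-linearization. Let $m\ge 0$, $A_\ell\in\mathbb{R}^{(n+m)\times(n+m)}$, $B_\ell,D_\ell\in\mathbb{R}^{n+m}$, and let $p=(p_1,\dots,p_m):\mathbb{R}^n\to\mathbb{R}^m$ be a smooth map. One says that $(f,g)$ is super-linearized to $(A_\ell,B_\ell,D_\ell)$ via $p$, and that $(A_\ell,B_\ell,D_\ell,p)$ is a super-linearization of $(f,g)$, if for every $x_0\in\mathbb{R}^n$ and every control $u$, the solution $z(t)\in\mathbb{R}^{n+m}$ of $\dot z=A_\ell z+B_\ell u+D_\ell$, $z(0)=(x_0,p(x_0))$, and the solution $x(t)$ of $\dot x=f(x)+u\,g(x)$, $x(0)=x_0$, satisfy $\Pi z(t)=x(t)$ for all $t$, where $\Pi:\mathbb{R}^{n+m}\to\mathbb{R}^n$ is the projection onto the first $n$ coordinates. The functions $p_1,\dots,p_m$ are called the observables. Visible and hidden observables. Partition $A_\ell=\begin{bmatrix}A&G\\H&M\end{bmatrix}$ with $A\in\mathbb{R}^{n\times n}$, $G\in\mathbb{R}^{n\times m}$, $H\in\mathbb{R}^{m\times n}$, $M\in\mathbb{R}^{m\times m}$. The observable $p_j$ is visible if $G_{ij}\neq0$ for some $i\in\{1,\dots,n\}$, and hidden otherwise. Balanced. A super-linearization of a polynomial system is balanced if its observables are polynomials and the degrees of the hidden observables do not exceed the degree of the visible observables (here: of the single visible observable). The number of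 hidden observables is arbitrary. *)

(* Defs.v *)
(* mpoly must be imported before MathComp-Analysis: the reverse order is
   rejected because of incompatible notation levels. *)
From HB Require Import structures.
From mathcomp Require Import all_boot all_order all_algebra.
From mathcomp Require Import mpoly.
From mathcomp Require Import all_classical all_reals all_analysis.

Set Implicit Arguments.
Unset Strict Implicit.
Unset Printing Implicit Defensive.

Import Order.TTheory GRing.Theory Num.Theory.
Import numFieldNormedType.Exports.

Local Open Scope classical_set_scope.
Local Open Scope ring_scope.

Definition polynomial_eval (R : realType) (n m : nat)
    (q : 'I_m -> {mpoly R[n]}) (x : 'cV[R]_n) : 'cV[R]_m :=
  \col_i (q i).@[fun j => x j 0].

Definition polynomial_map (R : realType) (n m : nat)
    (F : 'cV[R]_n -> 'cV[R]_m) : Prop :=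
  exists q : 'I_m -> {mpoly R[n]}, F =1 polynomial_eval q.

Fixpoint Ck (R : realType) (n m k : nat) (F : 'cV[R]_n -> 'cV[R]_m) : Prop :=
  continuous F /\
  if k is k'.+1 then
    forall v : 'cV[R]_n,
      (forall x, derivable F x v) /\ Ck k' (fun x => 'D_v F x)
  else True.

Definition smooth (R : realType) (n m : nat) (F : 'cV[R]_n -> 'cV[R]_m) : Prop :=
  forall k, Ck k F.

(* Only the values on [0, +oo[ matter for the solutions below. *)
Definition piecewise_continuous (R : realType) (u : R -> R) : Prop :=
  (forall a b : R,
     finite_set [set t | t \in `[a, b] /\ ~ {for t, continuous u}]) /\
  (forall t : R, cvg (u @ t^'-) /\ cvg (u @ t^'+)).

(* x solves  dx/dt = F x + u (G x),  x 0 = x0,  on [0, T].  For a piecewise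
   continuous u this is the usual notion of solution: x is continuous and
   satisfies the equation away from the finitely many discontinuities of u. *)
Definition is_solution (R : realType) (N : nat) (F G : 'cV[R]_N -> 'cV[R]_N)
    (u : R -> R) (x0 : 'cV[R]_N) (T : R) (x : R -> 'cV[R]_N) : Prop :=
  [/\ x 0 = x0,
      {within `[0, T], continuous x} &
      forall t : R, t \in `]0, T[ -> {for t, continuous u} ->
        is_derive t (1 : R) x (F (x t) + u t *: G (x t))].

(* The identity Pi z = x is required on every interval [0, T] on which the
   two solutions exist. *)
Definition super_linearization (R : realType) (n m : nat)
    (f g : 'cV[R]_n -> 'cV[R]_n)
    (Al : 'M[R]_(n + m)) (Bl Dl : 'cV[R]_(n + m))
    (p : 'cV[R]_n -> 'cV[R]_m) : Prop :=
  smooth p /\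
  forall (x0 : 'cV[R]_n) (u : R -> R), piecewise_continuous u ->
  forall (T : R) (z : R -> 'cV[R]_(n + m)) (x : R -> 'cV[R]_n),
    0 < T ->
    is_solution (fun y => Al *m y + Dl) (fun=> Bl) u (col_mx x0 (p x0)) T z ->
    is_solution f g u x0 T x ->
    forall t : R, t \in `[0, T] -> usubmx (z t) = x t.

(* ursubmx Al is the block G of Al = [A G; H M]. *)
Definition visible (R : realType) (n m : nat) (Al : 'M[R]_(n + m)) (j : 'I_m) :
    bool :=
  [exists i : 'I_n, ursubmx Al i j != 0].

(* msize is 1 + the total degree (0 for the zero polynomial), so comparing
   msize is comparing degrees. *)
Definition balanced (R : realType) (n m : nat) (Al : 'M[R]_(n + m))
    (p : 'cV[R]_n -> 'cV[R]_m) : Prop :=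
  exists2 q : 'I_m -> {mpoly R[n]},
    p =1 polynomial_eval q &
    forall i, ~~ visible Al i ->
      (msize (q i) <= \max_(j | visible Al j) msize (q j))%N.

Definition part1 (R : realType) (n k : nat) (hk : (k <= n)%N)
    (x : 'cV[R]_n) : 'cV[R]_k :=
  usubmx (castmx (esym (subnKC hk), erefl) x).

Definition part2 (R : realType) (n k : nat) (hk : (k <= n)%N)
    (x : 'cV[R]_n) : 'cV[R]_(n - k) :=
  dsubmx (castmx (esym (subnKC hk), erefl) x).

(* Main.v *)
Require Import Defs.
From HB Require Import structures.
From mathcomp Require Import all_boot all_order all_algebra.
From mathcomp Require Import mpoly.
From mathcomp Require Import all_classical all_reals all_analysis.
From mathcomp Require Import zify ring lra.
Import Order.TTheory GRing.Theory Num.Theory.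
Import numFieldNormedType.Exports.
Local Open Scope ring_scope.
Set Implicit Arguments.
Unset Strict Implicit.
Unset Printing Implicit Defensive.

(* Let [s 0] be the visible observable and [M] the lower right block of [Al].
   Along a trajectory the lifted state may drift away from [p (x t)], but its
   combinations by the Krylov rows [e_j0 *m M ^+ k] do not; with constant
   controls this gives polynomials [s k], combinations of the observables, with
   f = A x + s_0(x) b + D,  g = B,  L_f (s k) = s (k+1) + affine,  L_B (s k)
   constant.  The term [s 0 * d_b (s k)] of [L_f (s k)] has to have degree at
   most that of [s 0] by balancedness, so the directional derivative [d_b (s k)]
   is constant.  The directions along which every [s k] has a constant
   derivative therefore form an [A]-invariant subspace containing [b] and [B];
   in a basis adapted to it, [x1] being the coordinates inside the subspace,
   [s 0] is linear in [x1] plus a polynomial in [x2]. *)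

(** * Derivatives and Lipschitz bounds of polynomial functions *)

(** The analytic properties below pass through sums and products, so this principle avoids any
    explicit handling of monomials. *)
Lemma mpoly_ring_ind (R : comNzRingType) (n : nat) (Q : {mpoly R[n]} -> Prop) :
  (forall c, Q c%:MP) -> (forall i, Q 'X_i) ->
  (forall p q, Q p -> Q q -> Q (p + q)) ->
  (forall p q, Q p -> Q q -> Q (p * q)) -> forall p, Q p.
Proof.
move=> QC QX QD QM p; rewrite (mpolyE p).
apply: big_ind => [||m _]; [by rewrite -mpolyC0 | exact: QD |].
rewrite -mul_mpolyC; apply: (QM) => //; rewrite mpolyXE_id.
apply: (big_ind Q) => [||i _]; [by rewrite -mpolyC1 | exact: QM |].
elim: (m i) => [|k IHk]; first by rewrite expr0 -mpolyC1.
by rewrite exprS; apply: (QM).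
Qed.

Lemma is_derive_cV (R : realType) (n : nat) (x : R -> 'cV[R]_n) (t : R) (v : 'cV[R]_n) :
  is_derive t 1 x v <-> forall i, is_derive t 1 (fun s => x s i 0) (v i 0).
Proof.
split=> [[dx <-] i|dx].
  apply: DeriveDef; first exact: (derivable_mxP _ _ _).1.
  by rewrite derive_mx // mxE.
have dx1 : derivable x t 1.
  by apply/derivable_mxP => i j; rewrite (ord1 j); case: (dx i).
apply: DeriveDef => //; rewrite derive_mx //; apply/matrixP => i j.
by rewrite mxE (ord1 j); case: (dx i).
Qed.

Lemma is_derive_meval (R : realType) (n : nat) (q : {mpoly R[n]})
    (x : R -> 'I_n -> R) (dx : 'I_n -> R) (t : R) :
  (forall i, is_derive t 1 (fun s => x s i) (dx i)) ->
  is_derive t 1 (fun s => q.@[x s]) (\sum_i (q^`M(i)).@[x t] * dx i).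
Proof.
move=> hx; elim/mpoly_ring_ind: q => [c|j|p q hp hq|p q hp hq].
- rewrite big1 => [|i _]; last by rewrite mderivC meval0 mul0r.
  have -> : (fun s => (c%:MP).@[x s]) = cst c by apply/funext => s; rewrite mevalC.
  exact: is_derive_cst.
- have -> : (fun s => ('X_j).@[x s]) = (fun s => x s j).
    by apply/funext => s; rewrite mevalXU.
  rewrite (bigD1 j) //= big1 => [|i ij]; last first.
    by rewrite mderivX mnm1E eq_sym (negbTE ij) scale0r meval0 mul0r.
  by rewrite mderivX mnm1E eqxx -{1}(add0m U_(j)%MM) addmK mpolyX0 scale1r addr0 meval1 mul1r.
- have -> : (fun s => (p + q).@[x s]) = (fun s => p.@[x s]) + (fun s => q.@[x s]).
    by apply/funext => s; rewrite mevalD.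
  apply: is_derive_eq; rewrite -big_split; apply: eq_bigr => i _.
  by rewrite mderivD mevalD mulrDl.
- have -> : (fun s => (p * q).@[x s]) = (fun s => p.@[x s]) * (fun s => q.@[x s]).
    by apply/funext => s; rewrite mevalM.
  apply: is_derive_eq; rewrite /GRing.scale /= !mulr_sumr -big_split.
  apply: eq_bigr => i _; rewrite mderivM mevalD !mevalM /=; ring.
Qed.

(** The bound [K] is carried along with the Lipschitz constant [L] because the product case needs
    it: [pq - p'q'] splits as [p(q - q') + (p - p')q']. *)
Lemma meval_bounded_lipschitz (R : realType) (n : nat) (q : {mpoly R[n]}) (r : R) :
  exists L K : R, [/\ 0 <= L, 0 <= K,
    forall x, (forall i, `|x i| <= r) -> `|q.@[x]| <= K &
    forall x y d, (forall i, `|x i| <= r) -> (forall i, `|y i| <= r) ->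
      (forall i, `|x i - y i| <= d) -> `|q.@[x] - q.@[y]| <= L * d].
Proof.
elim/mpoly_ring_ind: q => [c|j|p q|p q].
- exists 0, `|c|; split=> // [x _|x y d _ _ _]; first by rewrite mevalC.
  by rewrite !mevalC subrr normr0 mul0r.
- exists 1, `|r|; split=> // [x hx|x y d _ _ hd].
    by rewrite mevalXU (le_trans (hx j)) // ler_norm.
  by rewrite !mevalXU mul1r.
- move=> [L1 [K1 [L1p K1p B1 H1]]] [L2 [K2 [L2p K2p B2 H2]]].
  exists (L1 + L2), (K1 + K2).
  split=> [||x hx|x y d hx hy hd]; [exact: addr_ge0 | exact: addr_ge0 | |].
    by rewrite mevalD (le_trans (ler_normD _ _)) // lerD ?B1 ?B2.
  rewrite !mevalD opprD addrACA mulrDl (le_trans (ler_normD _ _)) //.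
  by rewrite lerD ?H1 ?H2.
- move=> [L1 [K1 [L1p K1p B1 H1]]] [L2 [K2 [L2p K2p B2 H2]]].
  exists (K1 * L2 + L1 * K2), (K1 * K2).
  split=> [||x hx|x y d hx hy hd];
    [by rewrite addr_ge0 ?mulr_ge0 | exact: mulr_ge0 | |].
    by rewrite mevalM normrM ler_pM ?B1 ?B2.
  have -> : (p * q).@[x] - (p * q).@[y] =
      p.@[x] * (q.@[x] - q.@[y]) + (p.@[x] - p.@[y]) * q.@[y].
    by rewrite !mevalM; ring.
  rewrite [leRHS]mulrDl (le_trans (ler_normD _ _)) // !normrM lerD //.
    by rewrite -mulrA ler_pM ?B1 ?H2.
  by rewrite mulrAC ler_pM ?B2 ?H1.
Qed.

(** Summing the constants over the family gives common ones; [0 <= d] lets a larger Lipschitz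
    constant replace a smaller one. *)
Lemma family_bounded_lipschitz (R : realType) (n m : nat)
    (q : 'I_m -> {mpoly R[n]}) (r : R) :
  exists L K : R, [/\ 0 <= L, 0 <= K,
    forall i x, (forall j, `|x j| <= r) -> `|(q i).@[x]| <= K &
    forall i x y d, (forall j, `|x j| <= r) -> (forall j, `|y j| <= r) ->
      (forall j, `|x j - y j| <= d) -> 0 <= d ->
      `|(q i).@[x] - (q i).@[y]| <= L * d].
Proof.
have [L hL] := choice (fun i => meval_bounded_lipschitz (q i) r).
have [K hK] := choice hL.
have L0 i : 0 <= L i by case: (hK i).
have K0 i : 0 <= K i by case: (hK i).
have le_sum (F : 'I_m -> R) i : (forall j, 0 <= F j) -> F i <= \sum_j F j.
  by move=> F0; rewrite (bigD1 i) //= lerDl sumr_ge0.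
exists (\sum_i L i), (\sum_i K i); split=> [||i x hx|i x y d hx hy hd d0].
- exact: sumr_ge0.
- exact: sumr_ge0.
- by case: (hK i) => _ _ /(_ x hx) + _ => /le_trans; apply; exact: le_sum.
- case: (hK i) => _ _ _ /(_ x y d hx hy hd) /le_trans; apply.
  by rewrite ler_wpM2r // le_sum.
Qed.

(** * Limits with geometric error bounds *)

(** Estimates for a limit are proved for its approximants up to a multiple of [2^-k]; this discards
    the error. *)
Lemma le_of_le_geometric (R : realType) (a b C : R) :
  (forall k, a <= b + C * 2^-1 ^+ k) -> a <= b.
Proof.
move=> h; apply/ler_addgt0Pr => e e0.
have [k hk] : exists k, C * 2^-1 ^+ k <= e; last by rewrite (le_trans (h k)) // lerD2l.
exists (Num.bound `|C / e|).
have hb : C / e < (Num.bound `|C / e|)%:R.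
  by rewrite (le_lt_trans (ler_norm _)) // archi_boundP.
rewrite exprVn ler_pdivrMr ?exprn_gt0 // mulrC -ler_pdivrMr //.
by rewrite (le_trans (ltW hb)) // -natrX ler_nat ltnW // ltn_expl.
Qed.

(* [u k -/+ 2^(1-k)] are monotone, which yields the limit as a supremum
   together with the error bound. *)
Lemma geometric_cauchy_limit (R : realType) (u : nat -> R) :
  (forall k, `|u k.+1 - u k| <= 2^-1 ^+ k) ->
  exists l, forall k, `|u k - l| <= 2 * 2^-1 ^+ k.
Proof.
move=> hu; set e := fun k : nat => 2 * (2^-1 : R) ^+ k.
have eS k : e k = 2 * e k.+1 by rewrite /e exprS; field.
have e0 k : 0 <= e k by rewrite mulr_ge0 // exprn_ge0 // invr_ge0.
have step k : `|u k.+1 - u k| <= e k.+1.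
  by rewrite (le_trans (hu k)) // /e exprS mulrA divff ?mul1r.
have up : {homo (fun k => u k - e k) : k j / (k <= j)%N >-> k <= j}.
  apply: homo_leq => [//|x y z|k]; first exact: le_trans.
  by move: (step k) (eS k); rewrite ler_norml => /andP[]; lra.
have dn : {homo (fun k => - (u k + e k)) : k j / (k <= j)%N >-> k <= j}.
  apply: homo_leq => [//|x y z|k]; first exact: le_trans.
  by move: (step k) (eS k); rewrite ler_norml => /andP[]; lra.
have ub j k : u j - e j <= u k + e k.
  have := up j (maxn j k) (leq_maxl _ _); have := dn k (maxn j k) (leq_maxr _ _).
  by move: (e0 (maxn j k)) => /=; lra.
set S := range (fun k => u k - e k).
have hS : has_sup S.
  split; first by exists (u 0%N - e 0%N), 0%N.
  by exists (u 0%N + e 0%N) => _ [k _ <-].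
exists (sup S) => k; rewrite ler_distlC; apply/andP; split.
  by apply: ub_le_sup; [case: hS | exists k].
by apply: ge_sup; [case: hS | move=> _ [j _ <-]].
Qed.

(** A quadratic remainder is an inequality between values of [f], so it survives pointwise limits.
    This is how the limit of the Picard iterates gets differentiated. *)
Lemma is_derive_quadratic (R : realType) (f : R -> R) (t v C d : R) :
  0 < d ->
  (forall s, `|s - t| < d -> `|f s - f t - (s - t) * v| <= C * `|s - t| ^+ 2) ->
  is_derive t 1 f v.
Proof.
move=> d0 hf.
suff h : ((fun h => h^-1 *: ((f \o shift t) (h *: 1) - f t)) @ 0^' --> v)%classic.
  by apply: DeriveDef; [apply/cvg_ex; exists v | exact: cvg_lim h].
apply/cvgrPdist_le => e e0; near=> h.
have h0 : h != 0 by near: h; exact: nbhs_dnbhs_neq.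
have hd : `|h| < d by near: h; exact: dnbhs0_lt.
(* [C] may be zero or negative, so [|C| + 1] replaces it as a divisor. *)
have C0 : 0 < `|C| + 1 by rewrite ltr_pwDr.
have he : `|h| < e / (`|C| + 1) by near: h; apply: dnbhs0_lt; rewrite divr_gt0.
have := hf (h + t); rewrite addrK => /(_ hd).
rewrite /= /GRing.scale /= mulr1 => H.
have -> : v - h^-1 * (f (h + t) - f t) = - (h^-1 * (f (h + t) - f t - h * v)).
  by field.
rewrite normrN normrM normfV ler_pdivrMl ?normr_gt0 //.
rewrite (le_trans H) // expr2 mulrA mulrC ler_wpM2l //.
rewrite ltr_pdivlMr // in he; apply: le_trans (ltW he); rewrite mulrC ler_wpM2l //.
by rewrite (le_trans (ler_norm _)) // lerDl.
Unshelve. all: by end_near. Qed.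

(** * Local existence for polynomial differential equations *)

Definition primitive_poly (R : numFieldType) (p : {poly R}) : {poly R} :=
  \sum_(i < size p) (p`_i / i.+1%:R) *: 'X^(i.+1).

Lemma deriv_primitive_poly (R : numFieldType) (p : {poly R}) :
  (primitive_poly p)^`() = p.
Proof.
rewrite -[RHS]coefK poly_def raddf_sum; apply: eq_bigr => i _ /=.
by rewrite derivZ derivXn -scalerMnr scalerMnl -mulr_natr divfK ?pnatr_eq0.
Qed.

Lemma primitive_poly0 (R : numFieldType) (p : {poly R}) : (primitive_poly p).[0] = 0.
Proof.
by rewrite horner_sum big1 // => i _; rewrite hornerZ hornerXn expr0n mulr0.
Qed.

Lemma horner_mmap (R : comNzRingType) (n : nat) (h : 'I_n -> {poly R})
    (q : {mpoly R[n]}) (t : R) :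
  (mmap polyC h q).[t] = q.@[fun i => (h i).[t]].
Proof.
elim/mpoly_ring_ind: q => [c|i|p q hp hq|p q hp hq].
- by rewrite mmapC hornerC mevalC.
- by rewrite mmapX mmap1U mevalXU.
- by rewrite mmapD hornerD mevalD hp hq.
- by rewrite rmorphM hornerM mevalM hp hq.
Qed.

(** Both orders of [a] and [b] are allowed, so that the estimate serves positive and negative times
    alike. *)
Lemma horner_mean_value (R : realType) (p : {poly R}) (K a b : R) :
  (forall c, (a <= c <= b) || (b <= c <= a) -> `|p^`().[c]| <= K) ->
  `|p.[b] - p.[a]| <= K * `|b - a|.
Proof.
move=> hK; wlog ab : a b hK / a <= b.
  move=> H; case: (leP a b) => [|/ltW] ab; first exact: H.
  by rewrite distrC (distrC b); apply: H => // c; rewrite orbC; exact: hK.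
have dp c : c \in `]a, b[ -> is_derive c 1 (horner p) p^`().[c].
  by move=> _; exact: is_derive_poly.
have cp : ({within `[a, b], continuous (horner p)})%classic.
  by apply: continuous_subspaceT; exact: continuous_horner.
have [c] := MVT_segment ab dp cp.
rewrite in_itv /= => hc ->; rewrite normrM ler_wpM2r //.
by apply: hK; rewrite hc.
Qed.

(* The Picard iterates of a polynomial equation started at a constant are
   polynomials in the time variable, so no integration theory is needed. *)
Fixpoint picard (R : realType) (n : nat) (q : 'I_n -> {mpoly R[n]}) (x0 : 'cV[R]_n)
    (k : nat) (i : 'I_n) : {poly R} :=
  if k is k'.+1 then (x0 i 0)%:P + primitive_poly (mmap polyC (picard q x0 k') (q i))
  else (x0 i 0)%:P.

Lemma picard0 (R : realType) (n : nat) (q : 'I_n -> {mpoly R[n]}) (x0 : 'cV[R]_n)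
    (k : nat) (i : 'I_n) : (picard q x0 k i).[0] = x0 i 0.
Proof. by case: k => [|k] /=; rewrite !hornerE ?primitive_poly0 ?addr0. Qed.

Lemma picard_deriv (R : realType) (n : nat) (q : 'I_n -> {mpoly R[n]}) (x0 : 'cV[R]_n)
    (k : nat) (i : 'I_n) (t : R) :
  (picard q x0 k.+1 i)^`().[t] = (q i).@[fun j => (picard q x0 k j).[t]].
Proof. by rewrite /= derivD derivC add0r deriv_primitive_poly horner_mmap. Qed.

(** For [|t| <= T] the iterates stay within 1 of [x0] and successive differences halve, so they
    converge pointwise. A mean value estimate for the iterates passes to the limit and gives a
    quadratic remainder. Times of both signs are covered because the derivative at 0 is
    two-sided. *)
Lemma polynomial_ode_local_solution (R : realType) (n : nat)
    (q : 'I_n -> {mpoly R[n]}) (x0 : 'cV[R]_n) :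
  exists (T : R) (x : R -> 'cV[R]_n), [/\ 0 < T, x 0 = x0 &
    forall t, `|t| < T -> is_derive t (1 : R) x (polynomial_eval q (x t))].
Proof.
(* The margin 2 leaves room for the iterates, at distance at most 1 from [x0], and for their limit,
   at distance at most 2. *)
pose r := \sum_i `|x0 i 0| + 2.
have x0r i : `|x0 i 0| <= r - 2.
  by rewrite addrK (bigD1 i) //= lerDl sumr_ge0.
have [L [K [L0 K0 hK hL]]] := family_bounded_lipschitz q r.
(* This choice yields [K * T <= 1], which keeps the iterates in the ball, and [L * T <= 1/2], which
   halves the differences. *)
pose T := (1 + K + 2 * L)^-1.
have T0 : 0 < T by rewrite invr_gt0; lra.
have TKL : T * (1 + K + 2 * L) = 1 by rewrite mulVf //; lra.
have TL0 : 0 <= T * L by rewrite mulr_ge0 // ltW.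
have TK0 : 0 <= T * K by rewrite mulr_ge0 // ltW.
have eT : T + T * K + 2 * (T * L) = 1 by apply: etrans TKL; ring.
have TK : K * T <= 1 by rewrite mulrC; lra.
have TL : L * T <= 2^-1 by rewrite mulrC; lra.
have hB (p1 p2 : {poly R}) s : (p1 - p2).[s] = p1.[s] - p2.[s].
  by rewrite hornerD hornerN.
pose X k t i := (picard q x0 k i).[t].
have X0 k i : X k 0 i = x0 i 0 by exact: picard0.
have near_x0 k t i : `|t| <= T -> `|X k t i - x0 i 0| <= 1.
  elim: k t i => [|k IH] t i ht; first by rewrite /X /= hornerC subrr normr0.
  rewrite -(X0 k.+1 i); apply: (@le_trans _ _ (K * `|t - 0|)); last first.
    by rewrite subr0 (le_trans _ TK) // ler_wpM2l.
  apply: horner_mean_value => c hc; rewrite picard_deriv; apply: hK => j.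
  have cT : `|c| <= T by move: ht; rewrite !ler_norml; case/orP: hc; lra.
  have := IH c j cT; have := x0r j; rewrite /X !ler_norml; lra.
have ball k t i : `|t| <= T -> `|X k t i| <= r.
  by move=> ht; have := near_x0 k t i ht; have := x0r i; rewrite !ler_norml; lra.
have lip k s t i : `|s| <= T -> `|t| <= T -> `|X k s i - X k t i| <= K * `|s - t|.
  move=> hs ht; case: k => [|k]; first by rewrite /X /= !hornerC subrr normr0 mulr_ge0.
  apply: horner_mean_value => c hc; rewrite picard_deriv; apply: hK => j.
  by apply: ball; move: hs ht; rewrite !ler_norml; case/orP: hc; lra.
have cauchy k t i : `|t| <= T -> `|X k.+1 t i - X k t i| <= 2^-1 ^+ k.
  elim: k t i => [|k IH] t i ht.
    by rewrite {2}/X /= hornerC expr0; exact: near_x0.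
  (* The difference of two iterates vanishes at time 0, so the mean value bound on [[0, t]] controls
     it. *)
  have -> : X k.+2 t i - X k.+1 t i =
      (picard q x0 k.+2 i - picard q x0 k.+1 i).[t] -
      (picard q x0 k.+2 i - picard q x0 k.+1 i).[0].
    by rewrite 2!hB !picard0 subrr subr0.
  apply: (@le_trans _ _ (L * 2^-1 ^+ k * `|t - 0|)).
    apply: horner_mean_value => c hc; rewrite derivB hB !picard_deriv.
    have cT : `|c| <= T by move: ht; rewrite !ler_norml; case/orP: hc; lra.
    apply: hL => [j|j|j|]; [exact: ball | exact: ball | exact: IH |].
    by rewrite exprn_ge0 // invr_ge0.
  have h0 : 0 <= (2^-1 : R) ^+ k by rewrite exprn_ge0 // invr_ge0.
  rewrite subr0 exprS mulrAC ler_wpM2r //.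
  by rewrite (le_trans _ TL) // ler_wpM2l.
(* The time bound sits inside the existential so that [choice] gives a total function, with the
   dummy value 0 at other times. *)
have lim (p : R * 'I_n) : exists l, `|p.1| <= T ->
    forall k, `|X k p.1 p.2 - l| <= 2 * 2^-1 ^+ k.
  case: (leP `|p.1| T) => [hp|_]; last by exists 0.
  have [l hl] := @geometric_cauchy_limit R (fun k => X k p.1 p.2)
    (fun k => cauchy k p.1 p.2 hp).
  by exists l.
have [l hl] := choice lim.
have {}hl t i k : `|t| <= T -> `|X k t i - l (t, i)| <= 2 * 2^-1 ^+ k.
  by move=> ht; exact: (hl (t, i) ht k).
exists T, (fun t => \col_i l (t, i)); split=> //.
  apply/matrixP => i j; rewrite mxE (ord1 j); apply/eqP; rewrite -subr_eq0.
  rewrite -normr_le0 distrC; apply: (@le_of_le_geometric _ _ _ 2) => k.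
  by rewrite add0r -(X0 k) hl // normr0 ltW.
move=> t ht; apply/is_derive_cV => i.
have -> : (fun s => (\col_i l (s, i)) i 0) = (fun s => l (s, i)).
  by apply/funext => s; rewrite mxE.
rewrite /polynomial_eval mxE; set v := _.@[_].
have T2 : 0 < T - `|t| by rewrite subr_gt0.
apply: (@is_derive_quadratic _ _ _ _ (L * K) (T - `|t|)) => // s hs.
have {ht} tT := ltW ht.
have sT : `|s| <= T.
  by rewrite -(subrK t s) (le_trans (ler_normD _ _)) // -lerBrDr ltW.
(* Replacing the limit by iterate [k+1] at [s] and at [t] costs [2 * 2^-1 ^+ k], and [key] adds
   [2 * L * |s - t| * 2^-1 ^+ k]; the 4 is generous. *)
apply: (@le_of_le_geometric _ _ _ (2 * L * `|s - t| + 4)) => k.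
set e := 2^-1 ^+ k; have e0 : 0 <= e by rewrite exprn_ge0 // invr_ge0.
have lr j : `|l (t, j)| <= r.
  have := hl t j 0%N tT; have := x0r j.
  by rewrite /X /= hornerC expr0 mulr1 !ler_norml; lra.
(* Subtracting [v *: 'X] turns the first-order remainder into an increment whose derivative is the
   field at iterate [k] minus the field at the limit point at time [t]. *)
have key : `|X k.+1 s i - X k.+1 t i - (s - t) * v| <=
    L * (K * `|s - t| + 2 * e) * `|s - t|.
  have -> : X k.+1 s i - X k.+1 t i - (s - t) * v =
      (picard q x0 k.+1 i - v *: 'X).[s] - (picard q x0 k.+1 i - v *: 'X).[t].
    by rewrite 2!hB !hornerZ !hornerX /X; ring.
  apply: horner_mean_value => c hc.
  rewrite derivB derivZ derivX hB hornerZ picard_deriv hornerC mulr1.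
  have cT : `|c| <= T by move: sT tT; rewrite !ler_norml; case/orP: hc; lra.
  apply: hL => [j|j|j|]; [exact: ball | by rewrite mxE | rewrite mxE |].
    have -> : (picard q x0 k j).[c] - l (t, j) =
      (X k c j - X k t j) + (X k t j - l (t, j)) by rewrite /X; ring.
    rewrite (le_trans (ler_normD _ _)) // lerD ?hl //.
    rewrite (le_trans (lip k c t j cT tT)) // ler_wpM2l //.
    by case: (leP t s) => st; case/orP: hc => /andP[h1 h2];
      do ?[rewrite !ger0_norm; lra | rewrite !ler0_norm; lra].
  by rewrite addr_ge0 // mulr_ge0.
have hs1 := hl s i k.+1 sT; have ht1 := hl t i k.+1 tT.
have eS : 2 * 2^-1 ^+ k.+1 = e by rewrite exprS mulrA divff ?mul1r.
rewrite eS in hs1 ht1.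
have -> : l (s, i) - l (t, i) - (s - t) * v =
  (X k.+1 s i - X k.+1 t i - (s - t) * v) - (X k.+1 s i - l (s, i))
   + (X k.+1 t i - l (t, i)) by ring.
rewrite (le_trans (ler_normD _ _)) // (le_trans (lerD (ler_normB _ _) ht1)) //.
have : L * (K * `|s - t| + 2 * e) * `|s - t| =
  L * K * `|s - t| ^+ 2 + 2 * L * `|s - t| * e by ring.
by move: key hs1; rewrite mulrDl; lra.
Qed.

(** * Trajectories of the system and of its lift *)

(** Only quotients from the right are compared, so the left endpoint is included. This matters at
    time 0, since a super-linearization says nothing about negative times. *)
Lemma is_derive_eq_on (R : realType) (a b t u v : R) (x y : R -> R) :
  t \in `[a, b[ -> (forall s, s \in `[a, b[ -> x s = y s) ->
  is_derive t 1 x u -> is_derive t 1 y v -> u = v.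
Proof.
move=> tab xy dx dy.
have [dz zv] : is_derive t 1 (x - y) (u - v) by exact: is_deriveB.
apply/eqP; rewrite -subr_eq0 -zv; apply/eqP; rewrite /derive.
move: dz; rewrite /derivable => /cvg_ex [/= l hl].
rewrite (cvg_lim _ hl) //.
pose quotient h := h^-1 *: (((x - y) \o shift t) (h *: 1) - (x - y) t).
have hr : (quotient h @[h --> 0^'+] --> l)%classic.
  exact: cvg_dnbhs_at_right hl.
have h0 : (quotient h @[h --> 0^'+] --> (0 : R))%classic.
  apply: cvg_near_cst; near=> h.
  have h0 : 0 < h by near: h; exact: nbhs_right_gt.
  have hb : h < b - t.
    by near: h; apply: nbhs_right_lt; have := tab; rewrite in_itv /= subr_gt0 => /andP[].
  have z s : s \in `[a, b[ -> (x - y) s = 0.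
    by move=> /xy hs; rewrite /GRing.add /= /GRing.opp /= hs subrr.
  rewrite /quotient /= /GRing.scale /= mulr1 !z ?subrr ?mulr0 //.
  by have := tab; rewrite !in_itv /=; have := h0; have := hb; lra.
by apply: (cvg_unique _ hr h0).
Unshelve. all: by end_near. Qed.

Lemma is_derive_cV_eq_on (R : realType) (n : nat) (a b t : R) (x y : R -> 'cV[R]_n)
    (u v : 'cV[R]_n) :
  t \in `[a, b[ -> (forall s, s \in `[a, b[ -> x s = y s) ->
  is_derive t (1 : R) x u -> is_derive t (1 : R) y v -> u = v.
Proof.
move=> tab xy /is_derive_cV dx /is_derive_cV dy; apply/matrixP => i j.
rewrite (ord1 j); apply: (is_derive_eq_on tab _ (dx i) (dy i)) => s /xy hs.
by rewrite hs.
Qed.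

Lemma piecewise_continuous_cst (R : realType) (c : R) :
  piecewise_continuous (fun _ : R => c).
Proof.
split=> [a b|t]; last by split; apply: is_cvg_cst.
rewrite (_ : [set _ | _]%classic = set0) ?finite_set0 //.
by apply/seteqP; split=> // t [_ []]; exact: cvg_cst.
Qed.

Lemma is_solution_of_derive (R : realType) (n : nat) (F G : 'cV[R]_n -> 'cV[R]_n)
    (c : R) (x0 : 'cV[R]_n) (T : R) (x : R -> 'cV[R]_n) :
  x 0 = x0 ->
  (forall t, t \in `[0, T] -> is_derive t (1 : R) x (F (x t) + c *: G (x t))) ->
  is_solution F G (fun=> c) x0 T x.
Proof.
move=> x00 dx; split=> // [|t tT _].
  by apply: derivable_within_continuous => t /dx [].
by apply: dx; move: tT; rewrite !in_itv /= => /andP[/ltW -> /ltW ->].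
Qed.

Lemma polynomial_map_affine (R : realType) (n m : nat) (A : 'M[R]_(m, n)) (d : 'cV[R]_m) :
  polynomial_map (fun x => A *m x + d).
Proof.
exists (fun i => \sum_j A i j *: 'X_j + (d i 0)%:MP) => x.
apply/matrixP => i j; rewrite (ord1 j) !mxE mevalD mevalC raddf_sum /=.
by congr (_ + _); apply: eq_bigr => k _; rewrite mevalZ mevalXU.
Qed.

Lemma polynomial_map_addZ (R : realType) (n m : nat) (f g : 'cV[R]_n -> 'cV[R]_m) (c : R) :
  polynomial_map f -> polynomial_map g -> polynomial_map (fun x => f x + c *: g x).
Proof.
move=> [qf hf] [qg hg]; exists (fun i => qf i + c *: qg i) => x.
by apply/matrixP => i j; rewrite hf hg !mxE mevalD mevalZ.
Qed.

Lemma polynomial_map_local_solution (R : realType) (n : nat) (F : 'cV[R]_n -> 'cV[R]_n)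
    (x0 : 'cV[R]_n) : polynomial_map F ->
  exists (T : R) (x : R -> 'cV[R]_n), [/\ 0 < T, x 0 = x0 &
    forall t, `|t| < T -> is_derive t (1 : R) x (F (x t))].
Proof.
move=> [q hq]; have [T [x [T0 x00 dx]]] := polynomial_ode_local_solution q x0.
by exists T, x; split=> // t /dx; rewrite hq.
Qed.

(** A constant control makes both systems autonomous polynomial equations, for which local solutions
    exist. The curve [w] is the lower block of the lifted state and may differ from [p (x t)] after
    time 0; the last identity equates two expressions for the derivative of [x]. *)
Lemma super_linearization_trajectory (R : realType) (n m : nat)
    (f g : 'cV[R]_n -> 'cV[R]_n) (Al : 'M[R]_(n + m)) (Bl Dl : 'cV[R]_(n + m))
    (p : 'cV[R]_n -> 'cV[R]_m) (x0 : 'cV[R]_n) (c : R) :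
  polynomial_map f -> polynomial_map g -> super_linearization f g Al Bl Dl p ->
  exists (T : R) (x : R -> 'cV[R]_n) (w : R -> 'cV[R]_m),
    [/\ 0 < T, x 0 = x0, w 0 = p x0 & forall t, t \in `[0, T[ ->
    [/\ is_derive t (1 : R) x (f (x t) + c *: g (x t)),
        is_derive t (1 : R) w (dlsubmx Al *m x t + drsubmx Al *m w t +
          c *: dsubmx Bl + dsubmx Dl) &
        f (x t) + c *: g (x t) = ulsubmx Al *m x t + ursubmx Al *m w t +
          c *: usubmx Bl + usubmx Dl]].
Proof.
move=> hf hg [_ hsl].
have [T1 [x [T10 x00 dx]]] := polynomial_map_local_solution x0 (polynomial_map_addZ c hf hg).
have [T2 [z [T20 z00 dz]]] := polynomial_map_local_solution (col_mx x0 (p x0))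
  (polynomial_map_addZ c (polynomial_map_affine Al Dl) (polynomial_map_affine 0 Bl)).
(* Halving keeps the closed interval [[0, T]] strictly inside both domains of existence. *)
pose T := Num.min T1 T2 / 2.
have T0 : 0 < T by rewrite divr_gt0 // lt_min T10.
have [TT1 TT2] : T < T1 /\ T < T2.
  by rewrite /T; case: (leP T1 T2) => h; split; lra.
have norm_itv t : t \in `[0, T] -> `|t| <= T.
  by rewrite in_itv /= => /andP[t0]; rewrite ger0_norm.
have itv_cc t : t \in `[0, T[ -> t \in `[0, T].
  by rewrite !in_itv /= => /andP[-> /ltW ->].
have {}dx t : t \in `[0, T] -> is_derive t (1 : R) x (f (x t) + c *: g (x t)).
  by move=> /norm_itv ht; exact: dx (le_lt_trans ht TT1).
have {}dz t : t \in `[0, T] -> is_derive t (1 : R) z (Al *m z t + Dl + c *: Bl).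
  move=> /norm_itv ht; have := dz t (le_lt_trans ht TT2).
  by rewrite mul0mx add0r.
have zx t : t \in `[0, T] -> usubmx (z t) = x t.
  apply: (hsl x0 (fun=> c)) => //; first exact: piecewise_continuous_cst.
    exact: (is_solution_of_derive (F := fun y => Al *m y + Dl) (G := fun=> Bl)).
  exact: is_solution_of_derive.
have split_field t : t \in `[0, T] -> Al *m z t + Dl + c *: Bl =
   col_mx (ulsubmx Al *m x t + ursubmx Al *m dsubmx (z t) + c *: usubmx Bl + usubmx Dl)
          (dlsubmx Al *m x t + drsubmx Al *m dsubmx (z t) + c *: dsubmx Bl + dsubmx Dl).
  move=> /zx <-; rewrite -{1}(submxK Al) -{1}(vsubmxK (z t)) -{1}(vsubmxK Bl) -{1}(vsubmxK Dl).
  by rewrite mul_block_col scale_col_mx !add_col_mx; congr col_mx; rewrite addrAC.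
exists T, x, (fun t => dsubmx (z t)); split=> // [|t tT0]; first by rewrite z00 col_mxKd.
have tT := itv_cc t tT0; split; first exact: dx.
- apply/is_derive_cV => i; have := (is_derive_cV _ _ _).1 (dz t tT) (rshift n i).
  rewrite split_field // col_mxEd.
  by congr is_derive; apply/funext => s; rewrite mxE.
- apply: (@is_derive_cV_eq_on _ _ 0 T t x (fun s => usubmx (z s))) => //.
  + by move=> s /itv_cc /zx.
  + exact: dx.
  apply/is_derive_cV => i; have := (is_derive_cV _ _ _).1 (dz t tT) (lshift m i).
  rewrite split_field // col_mxEu.
  by congr is_derive; apply/funext => s; rewrite mxE.
Qed.

(** * Krylov combinations of the observables *)

Lemma is_derive_row_mul (R : realType) (m : nat) (r : 'rV[R]_m) (w : R -> 'cV[R]_m)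
    (t : R) (dw : 'cV[R]_m) :
  is_derive t (1 : R) w dw ->
  is_derive t 1 (fun s => (r *m w s) 0 0) ((r *m dw) 0 0).
Proof.
move=> /is_derive_cV hw.
have -> : (fun s => (r *m w s) 0 0) = \sum_j (r 0 j *: (fun s => w s j 0)).
  by apply/funext => s; rewrite fct_sumE mxE.
rewrite mxE; apply: is_derive_sum => j.
Qed.

(** Every column of [ursubmx Al] other than column [j0] is zero, since its observable is hidden. *)
Lemma visible_column (R : realType) (n m : nat) (Al : 'M[R]_(n + m)) :
  #|[pred j | visible Al j]| = 1%N ->
  exists j0, [/\ forall j, visible Al j = (j == j0),
    exists i, ursubmx Al i j0 != 0 &
    forall y : 'cV[R]_m, ursubmx Al *m y = y j0 0 *: col j0 (ursubmx Al)].
Proof.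
move=> /mem_card1 [j0 hj0]; exists j0.
have vis j : visible Al j = (j == j0) by have := hj0 j; rewrite !inE.
split=> // [|y]; first by have := vis j0; rewrite eqxx => /existsP.
apply/matrixP => i k; rewrite (ord1 k) !mxE (bigD1 j0) //= big1 => [|j hj].
  by rewrite addr0 mulrC !mxE.
have /negbT : visible Al j = false by rewrite vis (negbTE hj).
by rewrite negb_exists => /forallP /(_ i); rewrite negbK => /eqP ->; rewrite mul0r.
Qed.

(** With [r k] the Krylov rows, [s k] is the polynomial of [r k *m p], and [h k], [d k], [e k] are
    [r k] times the lower blocks of [Al], [Dl], [Bl]. The vector [b] is the visible column. *)
Lemma super_linearization_observables (R : realType) (n m : nat)
    (f g : 'cV[R]_n -> 'cV[R]_n) (Al : 'M[R]_(n + m)) (Bl Dl : 'cV[R]_(n + m))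
    (p : 'cV[R]_n -> 'cV[R]_m) :
  polynomial_map f -> polynomial_map g -> super_linearization f g Al Bl Dl p ->
  balanced Al p -> #|[pred j | visible Al j]| = 1%N ->
  exists (s : nat -> {mpoly R[n]}) (b : 'cV[R]_n) (h : nat -> 'rV[R]_n) (d e : nat -> R),
    [/\ forall (x : 'cV[R]_n) (c : R), f x + c *: g x =
          ulsubmx Al *m x + (s 0%N).@[fun i => x i 0] *: b +
          c *: usubmx Bl + usubmx Dl,
        forall k (x : 'cV[R]_n) (c : R),
          \sum_i (s k)^`M(i).@[fun i => x i 0] * (f x + c *: g x) i 0 =
          (h k *m x) 0 0 + d k + c * e k + (s k.+1).@[fun i => x i 0] &
        forall k, (msize (s k) <= msize (s 0%N))%N].
Proof.
move=> hf hg hsl [q hq hdeg] /visible_column [j0 [vis [i0 Gi0] hG]].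
pose r k := iter k (fun r => r *m drsubmx Al) (delta_mx 0 j0 : 'rV[R]_m).
pose s k := \sum_j r k 0 j *: q j.
have sE k (x : 'cV[R]_n) : (s k).@[fun i => x i 0] = (r k *m p x) 0 0.
  rewrite raddf_sum mxE; apply: eq_bigr => j _ /=.
  by rewrite mevalZ hq mxE.
have r0E (y : 'cV[R]_m) : (r 0%N *m y) 0 0 = y j0 0 by rewrite /r /= -rowE mxE.
(* At time 0 the lifted state is exactly [(x, p x)], and any [x] can be the starting point. *)
have base (x : 'cV[R]_n) (c : R) : f x + c *: g x = ulsubmx Al *m x + ursubmx Al *m p x +
    c *: usubmx Bl + usubmx Dl.
  have [T [y [w [T0 y0 w0 /(_ 0)]]]] := super_linearization_trajectory x c hf hg hsl.
  by rewrite in_itv /= lexx T0 y0 w0 => /(_ isT) [].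
pose trajectory (T c : R) (x : R -> 'cV[R]_n) (w : R -> 'cV[R]_m) :=
    forall t : R, t \in `[0, T[ ->
    [/\ is_derive t (1 : R) x (f (x t) + c *: g (x t)),
        is_derive t (1 : R) w (dlsubmx Al *m x t + drsubmx Al *m w t +
          c *: dsubmx Bl + dsubmx Dl) &
        f (x t) + c *: g (x t) = ulsubmx Al *m x t + ursubmx Al *m w t +
          c *: usubmx Bl + usubmx Dl].
pose observed k := forall T c x w, trajectory T c x w -> forall t : R, t \in `[0, T[ ->
    (r k *m w t) 0 0 = (r k *m p (x t)) 0 0.
(* The function [r k *m w] of time is differentiated twice: by the chain rule, as [s k] along [x],
   and by the linear equation for [w]. *)
have transport k T c x w : observed k -> trajectory T c x w -> forall t, t \in `[0, T[ ->
    \sum_i (s k)^`M(i).@[fun i => x t i 0] * (f (x t) + c *: g (x t)) i 0 =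
    (r k *m (dlsubmx Al *m x t + drsubmx Al *m w t + c *: dsubmx Bl + dsubmx Dl)) 0 0.
  move=> obs traj t tT; have [dx dw _] := traj t tT.
  apply/esym; apply: (is_derive_eq_on tT _ (is_derive_row_mul (r k) dw)
    (is_derive_meval (s k) ((is_derive_cV _ _ _).1 dx))) => a aT /=.
  by rewrite sE; exact: (obs _ _ _ _ traj).
(* At time 0 [w] equals [p x], which turns the previous identity into one on the whole state
   space. *)
have lie k : observed k -> forall (x : 'cV[R]_n) (c : R),
    \sum_i (s k)^`M(i).@[fun i => x i 0] * (f x + c *: g x) i 0 =
    (r k *m (dlsubmx Al *m x + drsubmx Al *m p x + c *: dsubmx Bl + dsubmx Dl)) 0 0.
  move=> obs x c.
  have [T [y [w [T0 y0 w0 traj]]]] := super_linearization_trajectory x c hf hg hsl.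
  have := transport k T c y w obs traj 0.
  by rewrite in_itv /= lexx T0 y0 w0 => /(_ isT).
have add00 (a b : 'M[R]_1) : (a + b) 0 0 = a 0 0 + b 0 0 by rewrite mxE.
have scale00 c (a : 'M[R]_1) : (c *: a) 0 0 = c * a 0 0 by rewrite mxE.
(* For [k = 0], the two expressions of the velocity agree, and the visible column has a nonzero
   entry in row [i0]. For the successor, comparing [transport] with [lie] at the same point leaves
   [r k *m M] applied to [w t] and to [p (x t)], where [M] is [drsubmx Al]. *)
have obs k : observed k.
  elim: k => [|k IH] T c x w traj t tT.
    have [_ _] := traj t tT; rewrite !r0E base !hG => /addIr /addIr /addrI.
    move=> /matrixP /(_ i0 0); rewrite !mxE => /mulIf Gw.
    by apply/esym/Gw; move: Gi0; rewrite !mxE.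
  have := transport k T c x w IH traj t tT; rewrite (lie k IH).
  rewrite !mulmxDr !add00.
  by move=> /addIr /addIr /addrI; rewrite /r /= -!mulmxA => ->.
exists s, (col j0 (ursubmx Al)), (fun k => r k *m dlsubmx Al),
  (fun k => (r k *m dsubmx Dl) 0 0), (fun k => (r k *m dsubmx Bl) 0 0).
split=> [x c|k x c|k].
- by rewrite base hG sE r0E.
- rewrite (lie k (obs k)) sE !mulmxDr /r /= -scalemxAr -!mulmxA !add00.
  by rewrite scale00; ring.
have s0 : s 0%N = q j0.
  rewrite /s (bigD1 j0) //= big1 => [|j /negbTE jj0]; rewrite !mxE ?eqxx.
    by rewrite addr0 scale1r.
  by rewrite jj0 scale0r.
rewrite s0; apply: (big_ind (fun q' : {mpoly R[n]} => (msize q' <= msize (q j0))%N)).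
- by rewrite msize0.
- by move=> q1 q2 h1 h2; rewrite (leq_trans (msizeD_le _ _)) // geq_max h1.
move=> j _; apply: leq_trans (msizeZ_le _ _) _.
(* For a hidden [j], balancedness bounds the size by a maximum over the visible indices, which are
   reduced to [j0]. *)
have [->//|jj0] := eqVneq j j0.
have := hdeg j; rewrite vis jj0 => /(_ isT) /leq_trans; apply.
by rewrite (eq_bigl (pred1 j0)) ?big_pred1_eq.
Qed.

(** * Formal and directional derivatives of polynomials *)

Lemma msize_mderiv_le (R : idomainType) (n : nat) (q : {mpoly R[n]}) (i : 'I_n) :
  (msize q^`M(i) <= (msize q).-1)%N.
Proof.
rewrite msizeE; apply/bigmax_leqP_seq => m + _.
rewrite mcoeff_msupp mcoeff_mderiv => hm.
have : (m + U_(i))%MM \in msupp q.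
  by rewrite mcoeff_msupp; apply: contraNneq hm => ->; rewrite mul0rn.
by move/msize_mdeg_lt; rewrite mdegD mdeg1 addn1; case: (msize q).
Qed.

(** If the exponent [m i] is nonzero, the coefficient at [m] times [m i] is a coefficient of the
    derivative in direction [i]; in characteristic zero it must vanish. *)
Lemma mpolyC_of_mderiv0 (R : numDomainType) (n : nat) (q : {mpoly R[n]}) :
  (forall i, q^`M(i) = 0) -> q = (q@_0)%:MP.
Proof.
move=> dq; apply/mpolyP => m; rewrite mcoeffC.
have [->|m0] := eqVneq m 0%MM; first by rewrite mulr1.
rewrite mulr0.
have [i mi] : exists i, m i != 0%N.
  apply/existsP; apply: contraNT m0; rewrite negb_exists => /forallP h.
  by apply/eqP/mnmP => i; rewrite mnm0E; apply/eqP; have := h i; rewrite negbK.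
have mE : m = (m - U_(i) + U_(i))%MM.
  by rewrite submK //; apply/mnm_lepP => j; rewrite mnm1E; case: eqP => [<-|]; rewrite ?lt0n.
have := mcoeff_mderiv i q (m - U_(i))%MM.
rewrite dq mcoeff0 -mE => /esym/eqP; rewrite mulrn_eq0 /=.
by move/eqP.
Qed.

Lemma is_derive_meval_line (R : realType) (n : nat) (q : {mpoly R[n]}) (x v : 'I_n -> R)
    (t : R) :
  is_derive t 1 (fun s => q.@[fun i => x i + s * v i])
    (\sum_i q^`M(i).@[fun i => x i + t * v i] * v i).
Proof.
apply: (@is_derive_meval _ _ q (fun s i => x i + s * v i)) => i.
have -> : (fun s => x i + s * v i) = cst (x i) + (v i \*: id).
  by apply/funext => s; rewrite /GRing.add /= mulrC.
by apply: is_derive_eq; rewrite add0r /GRing.scale /= mulr1.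
Qed.

(** Induction on the size: differentiating along coordinate lines shows that the partial derivatives
    vanish everywhere too, so they are zero polynomials and [q] is a constant. *)
Lemma meval_eq0_poly0 (R : realType) (n : nat) (q : {mpoly R[n]}) :
  (forall x, q.@[x] = 0) -> q = 0.
Proof.
have [k] := ubnP (msize q); elim: k q => // k IH q hk hq.
have dq i : q^`M(i) = 0.
  have [q0|q0] := eqVneq (msize q) 0%N.
    by move/eqP: q0; rewrite msize_poly_eq0 => /eqP ->; rewrite mderiv0.
  apply: IH => [|x].
    by rewrite (leq_ltn_trans (msize_mderiv_le _ _)) // prednK ?lt0n.
  pose v j : R := (j == i)%:R.
  have [_] := is_derive_meval_line q x v 0.
  have -> : (fun s => q.@[fun i => x i + s * v i]) = cst 0 by apply/funext => s.
  rewrite derive_cst => /esym.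
  rewrite (bigD1 i) //= big1 => [|j ji]; last by rewrite /v (negbTE ji) mulr0.
  rewrite /v eqxx mulr1 addr0 => <-; apply: meval_eq => j.
  by rewrite mul0r addr0.
rewrite (mpolyC_of_mderiv0 dq); have := hq (fun=> 0).
by rewrite (mpolyC_of_mderiv0 dq) mevalC mcoeffC eqxx mulr1 => ->; rewrite mpolyC0.
Qed.

Lemma meval_cV_inj (R : realType) (n : nat) (p q : {mpoly R[n]}) :
  (forall x : 'cV[R]_n, p.@[fun i => x i 0] = q.@[fun i => x i 0]) -> p = q.
Proof.
move=> pq; apply/eqP; rewrite -subr_eq0; apply/eqP/meval_eq0_poly0 => x.
have := pq (\col_i x i).
have E : (fun i => (\col_i x i) i 0) = x by apply/funext => i; rewrite mxE.
by rewrite E mevalB => ->; rewrite subrr.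
Qed.

Definition directional (R : realType) (n : nat) (v : 'cV[R]_n) (q : {mpoly R[n]}) :
    {mpoly R[n]} :=
  \sum_i v i 0 *: q^`M(i).

Lemma directionalZD (R : realType) (n : nat) (a : R) (v w : 'cV[R]_n) (q : {mpoly R[n]}) :
  directional (a *: v + w) q = a *: directional v q + directional w q.
Proof.
rewrite /directional scaler_sumr -big_split; apply: eq_bigr => i _ /=.
by rewrite !mxE scalerDl scalerA.
Qed.

(** Along the line [x + s v], the function [q - s c] has zero derivative; its values at [s = 0] and
    [s = 1] are compared. *)
Lemma directional_const_shift (R : realType) (n : nat) (v : 'cV[R]_n) (q : {mpoly R[n]})
    (c : R) (x : 'cV[R]_n) :
  directional v q = c%:MP ->
  q.@[fun i => (x + v) i 0] = q.@[fun i => x i 0] + c.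
Proof.
move=> hc.
pose F := fun s : R => q.@[fun i => x i 0 + s * v i 0] - s * c.
have dF (t : R) : is_derive t 1 F 0.
  have -> : F = (fun s => q.@[fun i => x i 0 + s * v i 0]) - (c \*: id).
    by apply/funext => s; rewrite /F /GRing.add /= /GRing.opp /= mulrC.
  have h1 := is_derive_meval_line q (fun i => x i 0) (fun i => v i 0) t.
  apply: is_derive_eq; apply/eqP; rewrite subr_eq0; apply/eqP.
  rewrite /GRing.scale /= mulr1 -(mevalC (fun i => x i 0 + t * v i 0) c) -hc.
  by rewrite raddf_sum; apply: eq_bigr => i _ /=; rewrite mevalZ mulrC.
have := is_derive_0_is_cst 1 0 dF; rewrite /F.
rewrite mul0r subr0 mul1r => /eqP; rewrite subr_eq => /eqP h.
rewrite -[LHS](_ : q.@[fun i => x i 0 + 1 * v i 0] = _); last first.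
  by apply: meval_eq => i; rewrite mxE mul1r.
by rewrite h; congr (_ + _); apply: meval_eq => i; rewrite mul0r addr0.
Qed.

Lemma directionalM (R : realType) (n : nat) (v : 'cV[R]_n) (p q : {mpoly R[n]}) :
  directional v (p * q) = directional v p * q + p * directional v q.
Proof.
rewrite /directional mulr_suml mulr_sumr -big_split; apply: eq_bigr => i _ /=.
by rewrite mderivM scalerDr scalerAl scalerAr.
Qed.

Lemma directionalD (R : realType) (n : nat) (v : 'cV[R]_n) (p q : {mpoly R[n]}) :
  directional v (p + q) = directional v p + directional v q.
Proof.
rewrite /directional -big_split; apply: eq_bigr => i _ /=.
by rewrite mderivD scalerDr.
Qed.

Lemma directionalC (R : realType) (n : nat) (v : 'cV[R]_n) (c : R) :
  directional v c%:MP = 0.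
Proof. by rewrite /directional big1 // => i _; rewrite mderivC scaler0. Qed.

Lemma directionalZ (R : realType) (n : nat) (v : 'cV[R]_n) (c : R) (q : {mpoly R[n]}) :
  directional v (c *: q) = c *: directional v q.
Proof. by rewrite -!mul_mpolyC directionalM directionalC mul0r add0r. Qed.

Lemma directional_sum (R : realType) (n m : nat) (v : 'cV[R]_n)
    (q : 'I_m -> {mpoly R[n]}) :
  directional v (\sum_i q i) = \sum_i directional v (q i).
Proof.
apply: (big_morph (directional v)); first exact: directionalD.
by rewrite -mpolyC0 directionalC mpolyC0.
Qed.

Lemma directionalX (R : realType) (n : nat) (v : 'cV[R]_n) (j : 'I_n) :
  directional v 'X_j = (v j 0)%:MP.
Proof.
rewrite /directional (bigD1 j) //= big1 => [|i ij].
  by rewrite mderivX mnm1E eqxx -{1}(add0m U_(j)%MM) addmK mpolyX0 scale1r addr0 alg_mpolyC.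
by rewrite mderivX mnm1E eq_sym (negbTE ij) scale0r scaler0.
Qed.

Lemma directional_mderiv (R : realType) (n : nat) (v : 'cV[R]_n) (i : 'I_n)
    (q : {mpoly R[n]}) :
  directional v q^`M(i) = (directional v q)^`M(i).
Proof.
rewrite /directional raddf_sum; apply: eq_bigr => j _ /=.
by rewrite mderivZ mderiv_comm.
Qed.

Definition row_form (R : realType) (n : nat) (r : 'rV[R]_n) : {mpoly R[n]} :=
  \sum_j r 0 j *: 'X_j.

Lemma meval_row_form (R : realType) (n : nat) (r : 'rV[R]_n) (x : 'cV[R]_n) :
  (row_form r).@[fun i => x i 0] = (r *m x) 0 0.
Proof.
by rewrite raddf_sum mxE; apply: eq_bigr => j _ /=; rewrite mevalZ mevalXU.
Qed.

Lemma directional_row_form (R : realType) (n : nat) (r : 'rV[R]_n) (v : 'cV[R]_n) :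
  directional v (row_form r) = ((r *m v) 0 0)%:MP.
Proof.
rewrite directional_sum mxE raddf_sum; apply: eq_bigr => j _ /=.
by rewrite directionalZ directionalX -mul_mpolyC mpolyCM.
Qed.

Lemma msize_row_form (R : realType) (n : nat) (r : 'rV[R]_n) : (msize (row_form r) <= 2)%N.
Proof.
apply: (big_ind (fun q : {mpoly R[n]} => (msize q <= 2)%N)).
- by rewrite msize0.
- by move=> p q hp hq; rewrite (leq_trans (msizeD_le _ _)) // geq_max hp.
- by move=> j _; rewrite (leq_trans (msizeZ_le _ _)) // msizeX mdeg1.
Qed.

(** * The invariant subspace given by balancedness *)

Lemma balanced_invariant_subspace (R : realType) (n : nat) (f g : 'cV[R]_n -> 'cV[R]_n)
    (s : nat -> {mpoly R[n]}) (A : 'M[R]_n) (b B D : 'cV[R]_n) (h : nat -> 'rV[R]_n)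
    (d e : nat -> R) :
  (forall (x : 'cV[R]_n) (c : R), f x + c *: g x =
     A *m x + (s 0%N).@[fun i => x i 0] *: b + c *: B + D) ->
  (forall k (x : 'cV[R]_n) (c : R),
     \sum_i (s k)^`M(i).@[fun i => x i 0] * (f x + c *: g x) i 0 =
     (h k *m x) 0 0 + d k + c * e k + (s k.+1).@[fun i => x i 0]) ->
  (forall k, (msize (s k) <= msize (s 0%N))%N) ->
  exists S : 'cV[R]_n -> Prop,
    [/\ forall a v w, S v -> S w -> S (a *: v + w),
        forall v, S v -> S (A *m v), S b, S B &
        forall v, S v -> exists c, directional v (s 0%N) = c%:MP].
Proof.
move=> base lie size_s.
(* If [s 0] is constant the whole space qualifies; otherwise its size is at least 2, which the
   degree count needs to absorb affine terms. *)
have [s0|s0] := leqP (msize (s 0%N)) 1.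
  exists (fun=> True); split=> // v _; exists 0.
  by rewrite (msize1_polyC s0) directionalC mpolyC0.
(* [F] is [f] as a vector of polynomials, so that pointwise identities become identities between
   polynomials. *)
pose F i := row_form (row i A) + b i 0 *: s 0%N + (D i 0)%:MP.
have FE i (x : 'cV[R]_n) : (F i).@[fun i => x i 0] = (f x) i 0.
  have := base x 0; rewrite !scale0r !addr0 => ->.
  rewrite !mevalD mevalC mevalZ meval_row_form -row_mul !mxE.
  by rewrite (mulrC (b i 0)).
have lieF k : \sum_i (s k)^`M(i) * F i = row_form (h k) + (d k)%:MP + s k.+1.
  apply: meval_cV_inj => x; rewrite !mevalD mevalC meval_row_form raddf_sum /=.
  have := lie k x 0; rewrite mul0r addr0 => <-.
  by apply: eq_bigr => i _; rewrite mevalM FE scale0r addr0.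
have b_const k : exists c, directional b (s k) = c%:MP.
  (* This is the Lie derivative of [s k] without the affine part of the field. Its size is at most
     that of [s 0]: in each product the derivative loses a degree and the affine factor adds at most
     one. *)
  pose rest := row_form (h k) + (d k)%:MP + s k.+1 -
     \sum_i (s k)^`M(i) * (row_form (row i A) + (D i 0)%:MP).
  have prodE : s 0%N * directional b (s k) = rest.
    rewrite /rest -lieF -sumrB /directional mulr_sumr; apply: eq_bigr => i _.
    by rewrite -mul_mpolyC /F -mul_mpolyC; ring.
  have size_rest : (msize rest <= msize (s 0%N))%N.
    have le2 : (2 <= msize (s 0%N))%N by [].
    have sizeD (p q : {mpoly R[n]}) :
       (msize p <= msize (s 0%N))%N -> (msize q <= msize (s 0%N))%N ->
       (msize (p + q) <= msize (s 0%N))%N.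
      by move=> hp hq; rewrite (leq_trans (msizeD_le _ _)) // geq_max hp.
    have sizeC c : (msize (c%:MP : {mpoly R[n]}) <= 1)%N.
      by rewrite msizeC; case: (_ == _).
    rewrite /rest; apply: (sizeD).
      apply: (sizeD) => //; apply: (sizeD); first exact: leq_trans (msize_row_form _) le2.
      exact: leq_trans (sizeC _) (ltnW le2).
    rewrite msizeN; apply: (big_ind (fun q => (msize q <= msize (s 0%N))%N)) => //.
      by rewrite msize0.
    move=> i _; have [->|ds0] := eqVneq ((s k)^`M(i)) 0; first by rewrite mul0r msize0.
    have [->|l0] := eqVneq (row_form (row i A) + (D i 0)%:MP) 0.
      by rewrite mulr0 msize0.
    rewrite msizeM //.
    have l2 : (msize (row_form (row i A) + (D i 0)%:MP)%R <= 2)%N.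
      rewrite (leq_trans (msizeD_le _ _)) // geq_max msize_row_form.
      exact: leq_trans (sizeC _) _.
    have : (msize (s k)^`M(i) <= (msize (s 0%N)).-1)%N.
      by rewrite (leq_trans (msize_mderiv_le _ _)) // -!subn1 leq_sub2r.
    by move: le2 l2; set a := msize _; set c := msize _; set c' := msize _; lia.
  have [b0|b0] := eqVneq (directional b (s k)) 0; first by exists 0; rewrite mpolyC0.
  exists (directional b (s k))@_0; apply: msize1_polyC.
  have s0N0 : s 0%N != 0 by rewrite -msize_poly_eq0 -lt0n ltnW.
  (* Degrees add in a product of nonzero polynomials, so the factor multiplying [s 0] has degree
     0. *)
  move: size_rest; rewrite -prodE msizeM //; move: s0.
  by set a := msize _; set c := msize _; lia.
exists (fun v => forall k, exists c, directional v (s k) = c%:MP); split.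
- move=> a v w hv hw k; have [c hc] := hv k; have [c' hc'] := hw k.
  by exists (a * c + c'); rewrite directionalZD hc hc' mpolyCD -mul_mpolyC mpolyCM.
- move=> v hv k; have [c0 hc0] := hv 0%N; have [c1 hc1] := hv k.+1.
  have [ck hck] := hv k; have [cb hcb] := b_const k.
  (* Differentiating [lieF k] along [v] gives, on the left, the derivative of [s k] along [A *m v]
     plus [c0] times its derivative along [b]: the second derivatives vanish because [s k] has a
     constant derivative along [v]. *)
  exists ((h k *m v) 0 0 + c1 - c0 * cb).
  have := congr1 (directional v) (lieF k).
  rewrite !directionalD directionalC directional_row_form hc1 addr0 directional_sum.
  rewrite (eq_bigr (fun i => (A *m v) i 0 *: (s k)^`M(i) + c0 *: (b i 0 *: (s k)^`M(i)))).
    rewrite big_split /= -scaler_sumr -/(directional b (s k)) hcb => hA.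
    by rewrite mpolyCB mpolyCD -hA mpolyCM mul_mpolyC addrK.
  move=> i _; rewrite directionalM directional_mderiv hck mderivC mul0r add0r.
  rewrite /F !directionalD directionalC addr0 directional_row_form directionalZ hc0.
  have -> : (row i A *m v) 0 0 = (A *m v) i 0.
    by rewrite -row_mul mxE.
  by rewrite -!mul_mpolyC; ring.
- exact: b_const.
(* Subtracting the identities for the controls 1 and 0 isolates the derivative along [B]. *)
- move=> k; exists (e k); apply: meval_cV_inj => x.
  rewrite mevalC raddf_sum /=.
  have gB : g x = B.
    have := base x 1; have := base x 0; rewrite !scale0r !scale1r !addr0 => ->.
    by rewrite addrAC => /addIr /addrI.
  have := lie k x 1; have := lie k x 0; rewrite mul0r mul1r addr0 scale0r addr0 scale1r.
  move=> h0.
  rewrite gB => h1.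
  have : \sum_i (s k)^`M(i).@[fun i => x i 0] * (f x + B) i 0 =
      \sum_i (s k)^`M(i).@[fun i => x i 0] * f x i 0 +
      \sum_i (s k)^`M(i).@[fun i => x i 0] * B i 0.
    by rewrite -big_split; apply: eq_bigr => i _ /=; rewrite -mulrDr mxE.
  rewrite h0 h1 addrAC => /addrI ->.
  by apply: eq_bigr => i _; rewrite mevalZ mulrC.
- by move=> v hv; exact: hv.
Qed.

(** * Adapted coordinates and the normal form *)

(** A matrix of maximal rank among those whose row space lies in [S] works: adjoining a vector of
    [S] outside its row space would raise the rank. Transposes appear because matrix spaces consist
    of rows. *)
Lemma linear_set_row_space (R : fieldType) (n : nat) (S : 'cV[R]_n -> Prop) :
  S 0 -> (forall a v w, S v -> S w -> S (a *: v + w)) ->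
  exists U : 'M[R]_n, forall v, S v <-> (v^T <= U)%MS.
Proof.
move=> S0 Slin.
pose inS (U : 'M[R]_n) := forall w : 'rV[R]_n, (w <= U)%MS -> S w^T.
pose P k := `[< exists U, inS U /\ \rank U = k >].
have exP : exists k, P k.
  exists 0%N; apply/asboolP; exists 0; split; last exact: mxrank0.
  by move=> w; rewrite submx0 => /eqP ->; rewrite trmx0.
have bndP k : P k -> (k <= n)%N.
  by move=> /asboolP [U [_ <-]]; exact: rank_leq_row.
case: (ex_maxnP exP bndP) => k /asboolP [U [US <-]] Umax.
exists U => v; split=> [Sv|/US]; last by rewrite trmxK.
apply: contraT => vU.
have : P (\rank (U + v^T)%MS).
  apply/asboolP; exists (U + v^T)%MS; split=> // w /sub_addsmxP [[a b] /= ->].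
  rewrite (mx11_scalar b) mul_scalar_mx linearD linearZ /= trmxK addrC.
  by apply: Slin => //; apply: US; exact: submxMl.
move/Umax; rewrite leqNgt => /negP; case; apply: rank_ltmx.
rewrite ltmxE addsmxSl /=; apply: contra vU; apply: submx_trans; exact: addsmxSr.
Qed.

(** A plain matrix selecting the last [n - k] coordinates replaces the cast in [part2], so that
    everything becomes matrix algebra. *)
Definition proj2 (R : realType) (n k : nat) : 'M[R]_(n - k, n) :=
  \matrix_(i, j) ((k + i)%N == j)%:R.

Lemma part1E (R : realType) (n k : nat) (hk : (k <= n)%N) (x : 'cV[R]_n) :
  part1 hk x = pid_mx k *m x.
Proof.
apply/matrixP => i j; rewrite (ord1 j) /part1 !mxE castmxE /= cast_ord_id.
have ik : (i < n)%N by rewrite (leq_trans _ hk).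
rewrite (bigD1 (Ordinal ik)) //= big1 => [|l hl].
  rewrite !mxE /= eqxx ltn_ord mul1r addr0; congr (x _ _); exact: val_inj.
rewrite !mxE; have [e|_] := eqVneq (i : nat) l; last by rewrite mul0r.
by case/eqP: hl; apply: val_inj; rewrite /= -e.
Qed.

Lemma part2E (R : realType) (n k : nat) (hk : (k <= n)%N) (x : 'cV[R]_n) :
  part2 hk x = proj2 R n k *m x.
Proof.
apply/matrixP => i j; rewrite (ord1 j) /part2 !mxE castmxE /= cast_ord_id.
have ik : (k + i < n)%N by rewrite -ltn_subRL.
rewrite (bigD1 (Ordinal ik)) //= big1 => [|l hl].
  rewrite !mxE /= eqxx mul1r addr0; congr (x _ _); exact: val_inj.
rewrite !mxE; have [e|_] := eqVneq ((k + i)%N) l; last by rewrite mul0r.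
by case/eqP: hl; apply: val_inj; rewrite /= -e.
Qed.

Lemma proj2_pid (R : realType) (n k : nat) :
  proj2 R n k *m (pid_mx k : 'M[R]_(n, k)) = 0.
Proof.
apply/matrixP => i j; rewrite !mxE big1 // => l _; rewrite !mxE.
case: eqP => [<-|]; last by rewrite mul0r.
by case: eqP => [h|]; [have := ltn_ord j; rewrite -h ltnNge leq_addr | rewrite mulr0].
Qed.

Lemma pid_proj2_complete (R : realType) (n k : nat) :
  (pid_mx k : 'M[R]_(n, k)) *m (pid_mx k : 'M[R]_(k, n)) +
    (proj2 R n k)^T *m proj2 R n k = 1%:M.
Proof.
rewrite mul_pid_mx !minnn.
apply/matrixP => i j; rewrite !mxE.
have [ik|ki] := ltnP i k.
  rewrite andbT big1 ?addr0 // => l _; rewrite !mxE.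
  by case: eqP => [h|]; [move: ik; rewrite -h ltnNge leq_addr | rewrite mul0r].
rewrite andbF add0r.
have il : (i - k < n - k)%N by rewrite ltn_sub2r // (leq_ltn_trans ki).
rewrite (bigD1 (Ordinal il)) //= big1 => [|l hl].
  by rewrite !mxE /= subnKC // eqxx mul1r addr0.
rewrite !mxE; have [e|_] := eqVneq (k + l)%N i; last by rewrite mul0r.
by case/eqP: hl; apply: val_inj; rewrite /= -e addKn.
Qed.

Lemma pullback_polynomial (R : realType) (n k l : nat) (q : {mpoly R[n]})
    (Q : 'M[R]_(n, k)) (a c : 'cV[R]_l) :
  polynomial_map (fun y : 'cV[R]_k => q.@[fun i => (Q *m y) i 0] *: a + c).
Proof.
pose t := [tuple row_form (row i Q) | i < n].
exists (fun i => a i 0 *: (q \mPo t) + (c i 0)%:MP) => y.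
apply/matrixP => i j; rewrite (ord1 j) !mxE mevalD mevalZ mevalC comp_mpoly_meval.
rewrite mulrC; congr (_ * _ + _); apply: meval_eq => h.
by rewrite tnth_mktuple meval_row_form -row_mul [in RHS]mxE.
Qed.

Lemma normal_form (R : realType) (n : nat) (f g : 'cV[R]_n -> 'cV[R]_n)
    (A : 'M[R]_n) (b B D : 'cV[R]_n) (s : {mpoly R[n]}) (S : 'cV[R]_n -> Prop) :
  f 0 = 0 ->
  (forall (x : 'cV[R]_n) (c : R), f x + c *: g x =
     A *m x + s.@[fun i => x i 0] *: b + c *: B + D) ->
  (forall a v w, S v -> S w -> S (a *: v + w)) ->
  (forall v, S v -> S (A *m v)) -> S b -> S B ->
  (forall v, S v -> exists c, directional v s = c%:MP) ->
  exists (P : 'M[R]_n) (k : nat) (hk : (k <= n)%N)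
         (A11 : 'M[R]_k) (A12 : 'M[R]_(k, n - k)) (A22 : 'M[R]_(n - k))
         (B' : 'cV[R]_k) (p' : 'cV[R]_(n - k) -> 'cV[R]_k),
    [/\ P \in unitmx,
        polynomial_map p' &
        forall (x : 'cV[R]_n) (u : R),
          let x1 := part1 hk (P *m x) in
          let x2 := part2 hk (P *m x) in
          let dx := P *m (f x + u *: g x) in
          part1 hk dx = A11 *m x1 + A12 *m x2 + p' x2 + u *: B' /\
          part2 hk dx = A22 *m x2].
Proof.
move=> f0 base Slin SA Sb SB Sdir.
(* [S] is nonempty since it contains [b], and [0 = (-1) b + b]. *)
have S0 : S 0 by rewrite -(addNr b) -scaleN1r; exact: Slin.
have [U SU] := linear_set_row_space S0 Slin.
pose k := \rank U; have hk : (k <= n)%N by exact: rank_leq_row.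
(* The first [k] rows of [row_ebase U] form a basis of its row space, so the first [k] columns of
   [N] span [S]. *)
pose N := (row_ebase U)^T.
have Nu : N \in unitmx by rewrite unitmx_tr row_ebase_unit.
pose P := invmx N.
pose E1 := pid_mx k : 'M[R]_(k, n); pose E2 := proj2 R n k.
pose Q1 := N *m (pid_mx k : 'M[R]_(n, k)); pose Q2 := N *m E2^T.
have SQ1 y : S (Q1 *m y).
  apply/SU; rewrite /Q1 !trmx_mul trmxK tr_pid_mx.
  by rewrite -(eq_row_base U) /row_base submxMl.
have PS v : S v -> E2 *m (P *m v) = 0.
  move=> /SU; rewrite -(eq_row_base U) => /submxP [a /(congr1 trmx)].
  rewrite trmxK /row_base !trmx_mul tr_pid_mx -/N => ->.
  by rewrite /P -!mulmxA mulKmx // !mulmxA proj2_pid mul0mx.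
have xE x : x = Q1 *m (E1 *m (P *m x)) + Q2 *m (E2 *m (P *m x)).
  rewrite !(mulmxA Q1) !(mulmxA Q2) -mulmxDl /Q1 /Q2 -!(mulmxA N) -mulmxDr.
  by rewrite pid_proj2_complete mulmx1 /P mulmxA mulmxV // mul1mx.
(* The gradient of [s] at 0 expresses the constant derivative along [v] in [S] linearly in [v]. *)
pose lam := \row_i (s^`M(i)).@[fun=> 0].
have shift v x : S v -> s.@[fun i => (x + v) i 0] = s.@[fun i => x i 0] + (lam *m v) 0 0.
  move=> /Sdir [c hc]; rewrite (directional_const_shift x hc); congr (_ + _).
  rewrite -(mevalC (fun _ : 'I_n => 0) c) -hc raddf_sum mxE.
  by apply: eq_bigr => i _ /=; rewrite mevalZ mxE mulrC.
(* The condition [f 0 = 0] makes [D] a multiple of [b], hence an element of [S]. *)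
have DE : D = - s.@[fun=> 0] *: b.
  have := base 0 0; rewrite f0 !scale0r !addr0 mulmx0 add0r.
  have -> : s.@[fun i => (0 : 'cV[R]_n) i 0] = s.@[fun=> 0].
    by apply: meval_eq => i; rewrite mxE.
  by move=> /esym /eqP; rewrite addrC addr_eq0 scaleNr => /eqP.
(* The part of [s] linear in [x1] is absorbed by [A11], while [p'] collects [s] at [Q2 *m x2] and
   the constant [D]. *)
exists P, k, hk, (E1 *m P *m (A *m Q1 + b *m (lam *m Q1))), (E1 *m P *m A *m Q2),
  (E2 *m P *m A *m Q2), (E1 *m P *m B),
  (fun y => s.@[fun i => (Q2 *m y) i 0] *: (E1 *m P *m b) + E1 *m P *m D).
split; first by rewrite unitmx_inv.
  exact: pullback_polynomial.
move=> x u /=; rewrite !part1E !part2E -/E1 -/E2 base.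
set x1 := E1 *m (P *m x); set x2 := E2 *m (P *m x).
have {}xE : x = Q1 *m x1 + Q2 *m x2 by exact: xE.
clearbody x1 x2; rewrite {}xE {x}.
split.
  rewrite [X in X *: b](_ : _ = s.@[fun i => (Q2 *m x2) i 0] + (lam *m (Q1 *m x1)) 0 0).
    have lamE : b *m (lam *m (Q1 *m x1)) = (lam *m (Q1 *m x1)) 0 0 *: b.
      by rewrite {1}(mx11_scalar (lam *m _)) mul_mx_scalar.
    rewrite scalerDl -lamE !(mulmxDr, mulmxDl) -!scalemxAr !mulmxA -!addrA.
    congr (_ + _); rewrite [RHS]addrCA; congr (_ + _); rewrite [RHS]addrCA.
    by congr (_ + (_ + _)); rewrite addrC.
  by rewrite -shift //; apply: meval_eq => i; rewrite addrC.
(* The vectors [b], [B], [D] and [A *m (Q1 *m x1)] lie in [S], so their second block vanishes and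
   only the [x2] term is left. *)
rewrite !mulmxDr -!scalemxAr.
rewrite (PS _ Sb) (PS _ SB) (PS _ (SA _ (SQ1 _))) !scaler0 DE -!scalemxAr (PS _ Sb).
by rewrite scaler0 !addr0 add0r !mulmxA.
Qed.

Theorem theorem3 (R : realType) (n : nat) (f g : 'cV[R]_n -> 'cV[R]_n)
    (hf : polynomial_map f) (hg : polynomial_map g) (hf0 : f 0 = 0)
    (hsl : exists (m : nat) (Al : 'M[R]_(n + m)) (Bl Dl : 'cV[R]_(n + m))
             (p : 'cV[R]_n -> 'cV[R]_m),
           [/\ super_linearization f g Al Bl Dl p,
               balanced Al p &
               #|[pred j | visible Al j]| = 1%N]) :
  exists (P : 'M[R]_n) (k : nat) (hk : (k <= n)%N)
         (A11 : 'M[R]_k) (A12 : 'M[R]_(k, n - k)) (A22 : 'M[R]_(n - k))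
         (B' : 'cV[R]_k) (p' : 'cV[R]_(n - k) -> 'cV[R]_k),
    [/\ P \in unitmx,
        polynomial_map p' &
        forall (x : 'cV[R]_n) (u : R),
          let x1 := part1 hk (P *m x) in
          let x2 := part2 hk (P *m x) in
          let dx := P *m (f x + u *: g x) in
          part1 hk dx = A11 *m x1 + A12 *m x2 + p' x2 + u *: B' /\
          part2 hk dx = A22 *m x2].
Proof.
have [m [Al [Bl [Dl [p [sl bal vis]]]]]] := hsl.
have [s [b [h [d [e [base lie size_s]]]]]] :=
  super_linearization_observables hf hg sl bal vis.
have [S [Slin SA Sb SB Sdir]] := balanced_invariant_subspace base lie size_s.
exact: (normal_form hf0 base Slin SA Sb SB Sdir).
Qed.
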